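(* Let $\psi$ be the linear map from the complexification $\mathcal H(K)_{\mathbb C}$ of $\mathcal H(K)$ into the Hardy space $\mathbf H^2(\mathbb D)$ determined (by linearity and continuity) by $\psi(e_n)=z^n$, $n\in\mathbb Z_+$. Then $\psi$ is unitary from $\mathcal H(K)_{\mathbb C}$ onto $\mathbf H^2(\mathbb D)$. Moreover, for $a\in\mathbb D$, $\psi$ maps the function $f_a^\blacktriangle: x\mapsto(1+\overline a)^x$, $x\in\mathbb Z_+$, to the function $z\mapsto\frac{1}{1-z\overline a}$, $z\in\mathbb D$. In particular, for $a,b\in\mathbb D$, $$\langle f_a^\blacktriangle,f_b^\blacktriangle\rangle_{\mathcal H(K)_{\mathbb C}}=\frac{1}{1-\overline a\,b}.$$
   Context: $\mathbb Z_+=\{0,1,2,\ldots\}$; $\mathbb D$ is the open unit disk of $\mathbb C$. $e_n(x)=\binom{x}{n}$ if $x\ge n$ and $0$ if $x<n$. $K(x,y)=\sum_n e_n(x)e_n(y)=\binom{x+y}{x}$, and $\mathcal H(K)$ is the reproducing kernel Hilbert space of real functions on $\mathbb Z_+$ with kernel $K$; it consists of all $\sum_n a_ne_n$ with $a_n$ real, $\sum a_n^2<\infty$, and the $e_n$ form an orthonormal basis. Its complexification $\mathcal H(K)_{\mathbb C}$ consists of all $\sum_n a_ne_n$ with $a_n\in\mathbb C$, $\sum|a_n|^2<\infty$, with inner product $\langle\sum a_ne_n,\sum b_ne_n\rangle=\sum a_n\overline{b_n}$ (linear in the first variable). $\mathbf H^2(\mathbb D)$ is the space of $f(z)=\sum_{n\ge0}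 a_nz^n$ analytic in $\mathbb D$ with $\|f\|_2^2=\sum|a_n|^2<\infty$. For $f_a(j)=\overline a^{\,j}$, $f_a^\blacktriangle(x)=\sum_{j=0}^x\binom{x}{j}f_a(j)=(1+\overline a)^x$ (with $\overline a^{\,0}=1$). *)

(* Defs.v *)
From HB Require Import structures.
From mathcomp Require Import all_boot all_order all_algebra.
From mathcomp Require Import complex.
From mathcomp Require Import all_classical all_reals all_analysis.
From mathcomp Require Import ring.

Set Implicit Arguments.
Unset Strict Implicit.
Unset Printing Implicit Defensive.

Import Order.TTheory GRing.Theory Num.Theory.
Import numFieldNormedType.Exports.
Local Open Scope classical_set_scope.
Local Open Scope ring_scope.

(* R[i] seen as a numClosedFieldType, so that it carries the topology that
   MathComp-Analysis attaches to the norm of a numClosedFieldType (R[i] itself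
   has no topological instance). *)
Definition cplx (R : realType) : numClosedFieldType := R[i]%C.

Definition cmod (R : realType) (z : cplx R) : R := Normc.normc z.

Definition disk (R : realType) := {z : cplx R | cmod z < 1}.

Definition sq_summable (R : realType) (a : nat -> cplx R) : Prop :=
  cvgn (series (fun n => cmod (a n) ^+ 2)).

Definition expands (R : realType) (T : Type) (e : nat -> T -> cplx R)
    (a : nat -> cplx R) (f : T -> cplx R) : Prop :=
  forall x, series (fun n => a n * e n x) @ \oo --> f x.

(* The functions \sum_n a_n e_n with \sum_n |a_n|^2 < oo.  Both H(K)_C and
   H^2(D) are of this form: for H^2(D), e n is z |-> z^n, and a function on the
   disk that is everywhere the sum of a power series is analytic there. *)
Definition l2span (R : realType) (T : Type) (e : nat -> T -> cplx R) :
    {pred T -> cplx R} :=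
  fun f => `[< exists2 a, sq_summable a & expands e a f >].

Record l2fun (R : realType) (T : Type) (e : nat -> T -> cplx R) := L2Fun {
  l2fun_val :> T -> cplx R;
  l2fun_in : l2fun_val \in l2span e }.

(* Well defined only when the coefficients of f are unique, which holds for the
   two families e used below; otherwise (or outside l2span e) a junk value. *)
Definition coef (R : realType) (T : Type) (e : nat -> T -> cplx R)
    (f : T -> cplx R) : nat -> cplx R :=
  xget (fun=> 0) [set a | sq_summable a /\ expands e a f].

Definition inner (R : realType) (T : Type) (e : nat -> T -> cplx R)
    (f g : l2fun e) : cplx R :=
  limn (series (fun n => coef e f n * (coef e g n)^* )).

Definition l2norm (R : realType) (T : Type) (e : nat -> T -> cplx R)
    (f : l2fun e) : R :=
  Num.sqrt (limn (series (fun n => cmod (coef e f n) ^+ 2))).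

Section L2Lmodule.
Variable R : realType.

Lemma cmodZD_sq (k x y : cplx R) :
  cmod (k * x + y) ^+ 2 <= 2 * (cmod k ^+ 2 * cmod x ^+ 2 + cmod y ^+ 2).
Proof.
have h : cmod (k * x + y) <= cmod k * cmod x + cmod y.
  have := @le_normcD R (k * x) y.
  by rewrite Normc.normcM.
have p0 (z : cplx R) : 0 <= cmod z by case: z => ? ?; exact: sqrtr_ge0.
rewrite -exprMn.
have := p0 (k * x + y); have := mulr_ge0 (p0 k) (p0 x); have := p0 y.
move: h; set u := cmod k * cmod x; set v := cmod y; set w := cmod _.
move=> h v0 u0 w0.
apply: (@le_trans _ _ ((u + v) ^+ 2)); first by rewrite lerXn2r ?nnegrE ?addr_ge0.
rewrite -subr_ge0 (_ : _ - _ = (u - v) ^+ 2) ?sqr_ge0 //.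
by rewrite sqrrB sqrrD exprMn; ring.
Qed.

Lemma sq_summableZD (k : cplx R) (a b : nat -> cplx R) :
  sq_summable a -> sq_summable b -> sq_summable (fun n => k * a n + b n).
Proof.
move=> ha hb.
apply: (@series_le_cvg _ _ (2 *: (cmod k ^+ 2 *: (fun n => cmod (a n) ^+ 2 : R)
   + (fun n => cmod (b n) ^+ 2)))).
- by move=> n; exact: sqr_ge0.
- by move=> n; rewrite /= mulr_ge0 // addr_ge0 ?sqr_ge0 // mulr_ge0 ?sqr_ge0.
- by move=> n; exact: cmodZD_sq.
- apply: is_cvg_seriesZ; apply: is_cvg_seriesD => //.
  exact: is_cvg_seriesZ.
Qed.

Lemma expandsZD (T : Type) (e : nat -> T -> cplx R) (k : cplx R) a b f g :
  expands e a f -> expands e b g ->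
  expands e (fun n => k * a n + b n) (k *: f + g).
Proof.
move=> ha hb x.
rewrite (_ : series _ = fun n => k * series (fun n => a n * e n x) n
                                 + series (fun n => b n * e n x) n).
  exact: cvgD (cvgM (cvg_cst k) (ha x)) (hb x).
apply/funext => n; rewrite /series /= mulr_sumr -big_split /=.
by apply: eq_bigr => i _; rewrite mulrDl mulrA.
Qed.

Variables (T : Type) (e : nat -> T -> cplx R).

Lemma l2span_submod_closed : submod_closed (l2span e).
Proof.
split.
  apply/asboolP; exists (fun=> 0).
    rewrite /sq_summable (_ : (fun n => _) = fun=> 0 :> R).
      by rewrite (_ : series _ = fun=> 0); [exact: is_cvg_cst|
        apply/funext => n; rewrite /series /= big1].
    by apply/funext => _; rewrite /cmod Normc.normc0 expr0n.
  move=> x; rewrite (_ : series _ = fun=> 0); first exact: cvg_cst.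
  by apply/funext => n; rewrite /series /= big1 // => i _; rewrite mul0r.
move=> k f g /asboolP[a ha hf] /asboolP[b hb hg].
apply/asboolP; exists (fun n => k * a n + b n); first exact: sq_summableZD.
exact: expandsZD.
Qed.

HB.instance Definition _ := [isSub for @l2fun_val R T e].
HB.instance Definition _ := [Choice of l2fun e by <:].
HB.instance Definition _ :=
  GRing.isSubmodClosed.Build _ _ (l2span e) l2span_submod_closed.
HB.instance Definition _ := [SubChoice_isSubLmodule of l2fun e by <:].

End L2Lmodule.

Section Basis.
Variables (R : realType) (T : Type) (e : nat -> T -> cplx R).

Lemma series_fin (V : normedModType R) (u : nat -> V) N :
  (forall n, (N <= n)%N -> u n = 0) -> series u @ \oo --> \sum_(n < N) u n.
Proof.
move=> u0; apply: cvg_near_cst; exists N => // n /= Nn.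
rewrite /series /= -(big_mkord xpredT u) (big_cat_nat (n := N)) //=.
rewrite big_mkord [X in _ + X]big_nat [X in _ + X]big1 ?addr0 // => i.
by case/andP=> /u0.
Qed.

Lemma series_finC (u : nat -> cplx R) N :
  (forall n, (N <= n)%N -> u n = 0) -> series u @ \oo --> \sum_(n < N) u n.
Proof.
move=> u0; apply: cvg_near_cst; exists N => // n /= Nn.
rewrite /series /= -(big_mkord xpredT u) (big_cat_nat (n := N)) //=.
rewrite big_mkord [X in _ + X]big_nat [X in _ + X]big1 ?addr0 // => i.
by case/andP=> /u0.
Qed.

Lemma sq_summable_fin (a : nat -> cplx R) N :
  (forall n, (N <= n)%N -> a n = 0) -> sq_summable a.
Proof.
move=> a0; apply/cvg_ex; eexists; apply: (@series_fin R _ N) => n /a0 ->.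
by rewrite /cmod Normc.normc0 expr0n.
Qed.

Lemma basis_in n : e n \in l2span e.
Proof.
have a0 k : (n.+1 <= k)%N -> (k == n)%:R = 0 :> cplx R by case: ltngtP.
apply/asboolP; exists (fun k => (k == n)%:R); first exact: sq_summable_fin a0.
move=> x; rewrite (_ : e n x = \sum_(k < n.+1) (k == n :> nat)%:R * e k x).
  by apply: series_finC => k /a0 ->; rewrite mul0r.
rewrite (bigD1 ord_max) //= eqxx mul1r big1 ?addr0 // => i ni.
by rewrite -val_eqE /= in ni; rewrite (negbTE ni) mul0r.
Qed.

Definition basis n : l2fun e := L2Fun (basis_in n).

End Basis.

Definition binom_fun (R : realType) (n x : nat) : cplx R := 'C(x, n)%:R.
Definition monomial (R : realType) (n : nat) (z : disk R) : cplx R := sval z ^+ n.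

Definition HKC (R : realType) := l2fun (@binom_fun R).
Definition Hardy (R : realType) := l2fun (@monomial R).

Definition e_ (R : realType) (n : nat) : HKC R := basis (@binom_fun R) n.
Definition zpow (R : realType) (n : nat) : Hardy R := basis (@monomial R) n.

Definition l2_continuous (R : realType) (S T : Type)
    (d : nat -> S -> cplx R) (e : nat -> T -> cplx R)
    (psi : l2fun d -> l2fun e) : Prop :=
  forall f (eps : R), 0 < eps -> exists2 delta : R, 0 < delta &
    forall g, l2norm (g - f) < delta -> l2norm (psi g - psi f) < eps.

Definition unitary (R : realType) (S T : Type)
    (d : nat -> S -> cplx R) (e : nat -> T -> cplx R)
    (psi : l2fun d -> l2fun e) : Prop :=
  bijective psi /\ forall f g, inner (psi f) (psi g) = inner f g.

Definition black_triangle (R : realType) (f : nat -> cplx R) (x : nat) :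
    cplx R :=
  \sum_(0 <= j < x.+1) 'C(x, j)%:R * f j.

Definition pow_conj (R : realType) (a : disk R) (j : nat) : cplx R :=
  (sval a)^* ^+ j.

Lemma black_triangle_pow_conj (R : realType) (a : disk R) (x : nat) :
  black_triangle (pow_conj a) x = (1 + (sval a)^* ) ^+ x.
Proof.
rewrite /black_triangle big_mkord exprDn; apply: eq_bigr => i _.
by rewrite expr1n mul1r mulr_natl.
Qed.

Section KernelFunctions.
Variable R : realType.

Lemma expands_binom (a : nat -> cplx R) :
  expands (@binom_fun R) a (black_triangle a).
Proof.
move=> x; rewrite /black_triangle big_mkord.
under eq_bigr do rewrite mulrC.
by apply: series_finC => n xn; rewrite /binom_fun bin_small ?mulr0.
Qed.

Lemma cmodX_conj (a : cplx R) n : cmod (a^* ^+ n) = cmod a ^+ n.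
Proof.
have -> : cmod (a^* ^+ n) = cmod a^* ^+ n.
  elim: n => [|n IH]; first exact: Normc.normc1.
  by rewrite !exprS -IH; exact: Normc.normcM.
by congr (_ ^+ n); case: a => x y; rewrite /cmod /= sqrrN.
Qed.

Lemma pow_conj_summable (a : disk R) : sq_summable (pow_conj a).
Proof.
rewrite /sq_summable /pow_conj; case: a => a /= a1.
have a0 : 0 <= cmod a by case: (a) => ? ?; exact: sqrtr_ge0.
rewrite (_ : (fun n => _) = geometric 1 (cmod a ^+ 2)).
  by apply: is_cvg_geometric_series; rewrite ger0_norm ?sqr_ge0 // expr_lt1.
by apply/funext => n; rewrite /= cmodX_conj mul1r -!exprM mulnC.
Qed.

Lemma f_triangle_in (a : disk R) :
  black_triangle (pow_conj a) \in l2span (@binom_fun R).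
Proof.
apply/asboolP; exists (pow_conj a); first exact: pow_conj_summable.
exact: expands_binom.
Qed.

Definition f_triangle (a : disk R) : HKC R := L2Fun (f_triangle_in a).

Lemma expands_binom_inj (a b : nat -> cplx R) f :
  expands (@binom_fun R) a f -> expands (@binom_fun R) b f -> a = b.
Proof.
move=> ha hb; have E x : black_triangle a x = black_triangle b x.
  have ua := cvg_unique (@norm_hausdorff _ (cplx R)) (ha x) (@expands_binom a x).
  have ub := cvg_unique (@norm_hausdorff _ (cplx R)) (hb x) (@expands_binom b x).
  by rewrite -ua -ub.
apply/funext => n; elim/ltn_ind: n => n IH; have := E n.
rewrite /black_triangle !big_nat_recr //= binn !mul1r.
rewrite (eq_big_nat _ _ (F2 := fun j => 'C(n, j)%:R * b j)); first exact: addrI.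
by move=> i /andP[_ /IH ->].
Qed.

(* K_reproducing identifies HKC as the complexified reproducing kernel Hilbert
   space of K. *)
Definition K (x y : nat) : cplx R := 'C(x + y, x)%:R.

Lemma K_expansion x y :
  series (fun n => binom_fun R n x * binom_fun R n y) @ \oo --> K x y.
Proof.
rewrite (_ : K x y = \sum_(n < x.+1) binom_fun R n x * binom_fun R n y).
  by apply: series_finC => n xn; rewrite /binom_fun bin_small ?mul0r.
rewrite /K addnC -binomial.Vandermonde natr_sum.
by apply: eq_bigr => -[i ilt] _ /=; rewrite natrM bin_sub // mulrC.
Qed.

Lemma K_in y : K^~ y \in l2span (@binom_fun R).
Proof.
apply/asboolP; exists (fun n => binom_fun R n y).
  by apply: (@sq_summable_fin R _ y.+1) => n yn; rewrite /binom_fun bin_small.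
move=> x; rewrite (_ : (fun n => _) = fun n => binom_fun R n x * binom_fun R n y).
  exact: K_expansion.
by apply/funext => n; rewrite mulrC.
Qed.

Lemma coef_binom a f : sq_summable a -> expands (@binom_fun R) a f ->
  coef (@binom_fun R) f = a.
Proof.
move=> ha hf; rewrite /coef; case: xgetP => [b _ [_ hb]|/(_ a)[]//].
exact: expands_binom_inj hb hf.
Qed.

Lemma K_reproducing (f : HKC R) (y : nat) : inner f (L2Fun (K_in y)) = f y.
Proof.
case: f => f fin; have /asboolP[a ha hf] := fin; rewrite /inner /=.
rewrite (coef_binom ha hf) (@coef_binom (fun n => binom_fun R n y)).
- rewrite (_ : (fun n => _) = fun n => a n * binom_fun R n y).
    exact: (cvg_lim (@norm_hausdorff _ (cplx R)) (hf y)).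
  by apply/funext => n; rewrite /binom_fun conjC_nat.
- by apply: (@sq_summable_fin R _ y.+1) => n yn; rewrite /binom_fun bin_small.
- move=> x; under [X in series X]funext do rewrite mulrC.
  exact: K_expansion.
Qed.

End KernelFunctions.

(* Main.v *)
From HB Require Import structures.
Require Import Defs.
From mathcomp Require Import all_boot all_order all_algebra.
From mathcomp Require Import complex ring lra.
From mathcomp Require Import all_classical all_reals all_analysis.
Import Order.TTheory GRing.Theory Num.Theory.
Import numFieldNormedType.Exports.
Local Open Scope classical_set_scope.
Local Open Scope ring_scope.

Set Implicit Arguments.
Unset Strict Implicit.
Unset Printing Implicit Defensive.

(** Both spaces are copies of l^2.  Suppose that a family e of functions has two
    properties: the coefficients of a square-summable expansion in e are
    determined by its sum ([coef_unique]), and every square-summable sequence is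
    the coefficient sequence of some expansion ([l2_converges]).  Then
    f |-> coef e f is a linear bijection from l2fun e onto l^2, and the norm and
    the inner product are those of the coefficients.

    For the binomial family the coefficients are found by inverting a triangular
    system and the sums are finite at each point.  For the monomials on the
    disk, uniqueness is the identity theorem for power series at the origin
    ([power_series_eq0]), and convergence holds because (z^n) is itself square
    summable, so that the series converges absolutely ([sq_summable_prod]).

    The map that keeps coefficients therefore exists, is linear and unitary, and
    sends e_n to z^n.  Conversely, a continuous linear psi with psi e_n = z^n
    keeps coefficients ([l2_continuous_basis_coef]): psi f is close in norm to
    psi of a long partial sum of f, whose first coefficients are those of f.
    This yields uniqueness, and reduces every claim on psi to coefficients.  As
    f_a^triangle has coefficients conj(a)^n, its image and the inner products of
    two such functions are geometric series. *)

(** * Convergence in the complex numbers *)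

Section ComplexConvergence.
Variable R : realType.
Implicit Types (z w : cplx R) (u : nat -> cplx R).

Lemma cmod_ge0 z : 0 <= cmod z. Proof. by case: z => x y; exact: sqrtr_ge0. Qed.

Lemma cmodM z w : cmod (z * w) = cmod z * cmod w. Proof. exact: Normc.normcM. Qed.

Lemma cmodD z w : cmod (z + w) <= cmod z + cmod w.
Proof. exact: (@le_normcD R). Qed.

Lemma cmodN z : cmod (- z) = cmod z. Proof. exact: (@normcN R). Qed.

Lemma cmod0 : cmod (0 : cplx R) = 0. Proof. exact: Normc.normc0. Qed.

Lemma cmod0_eq0 z : cmod z = 0 -> z = 0. Proof. exact: Normc.eq0_normc. Qed.

Lemma cmodX z n : cmod (z ^+ n) = cmod z ^+ n.
Proof.
by elim: n => [|n IH]; [exact: Normc.normc1 | rewrite !exprS cmodM IH].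
Qed.

Lemma cmod_real (r : R) : 0 <= r -> cmod (r%:C%C : cplx R) = r.
Proof.
by move=> r0; rewrite /cmod /= expr0n /= addr0 sqrtr_sqr ger0_norm.
Qed.

Lemma cmod_conj z : cmod z^* = cmod z.
Proof. by rewrite -[z^*]expr1 cmodX_conj. Qed.

Lemma cmod_conjM_disk (a b : disk R) : cmod ((sval a)^* * sval b) < 1.
Proof.
by case: a b => [a a1] [b b1] /=; rewrite cmodM cmod_conj mulr_ilt1 ?cmod_ge0.
Qed.

Lemma cmod_sum (I : Type) (r : seq I) (P : pred I) (F : I -> cplx R) :
  cmod (\sum_(i <- r | P i) F i) <= \sum_(i <- r | P i) cmod (F i).
Proof.
elim/big_ind2: _ => [|x1 x2 y1 y2 h1 h2|//]; first by rewrite cmod0.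
exact: le_trans (cmodD _ _) (lerD h1 h2).
Qed.

(** The topology of [cplx R] is given by balls with radii in [cplx R]; a positive
    radius is a positive real, so real radii suffice. *)
Lemma cvg_cplxP u z :
  u @ \oo --> z <-> forall eps : R, 0 < eps -> \forall n \near \oo, cmod (z - u n) < eps.
Proof.
split=> [/cvgrPdist_lt h eps e0|h].
  have e0' : 0 < (eps%:C%C : cplx R) by rewrite (ltcR 0 eps).
  near=> n; rewrite -(ltcR _ eps).
  by near: n; exact: (h _ e0').
apply/cvgrPdist_lt => -[x y]; rewrite ltcE /= => /andP[/eqP-> x0].
near=> n; rewrite [ltLHS](_ : _ = (cmod (z - u n))%:C%C) //.
rewrite (ltcR _ x); near: n; exact: h.
Unshelve. all: by end_near. Qed.

Lemma cvg_cplx (u v : nat -> R) x y : u @ \oo --> x -> v @ \oo --> y ->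
  (fun n => (u n +i* v n)%C : cplx R) @ \oo --> ((x +i* y)%C : cplx R).
Proof.
move=> /cvgrPdist_lt hu /cvgrPdist_lt hv; apply/cvg_cplxP => e e0.
have e20 : 0 < e / 2 by rewrite divr_gt0.
near=> n.
have -> : ((x +i* y)%C : cplx R) - (u n +i* v n)%C
   = ((x - u n)%:C)%C + (0 +i* (y - v n))%C by simpc.
apply: le_lt_trans (cmodD _ _) _; rewrite (splitr e) ltrD //.
  rewrite /cmod /= expr0n /= addr0 sqrtr_sqr.
  by near: n; exact: hu.
rewrite /cmod /= expr0n /= add0r sqrtr_sqr.
by near: n; exact: hv.
Unshelve. all: by end_near. Qed.

Lemma ler_Re z : `|complex.Re z| <= cmod z.
Proof.
by case: z => x y; rewrite /cmod /= -sqrtr_sqr ler_wsqrtr // lerDl sqr_ge0.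
Qed.

Lemma ler_Im z : `|complex.Im z| <= cmod z.
Proof.
by case: z => x y; rewrite /cmod /= -sqrtr_sqr ler_wsqrtr // lerDr sqr_ge0.
Qed.

(** Completeness of the complex numbers is obtained from that of the reals: the
    real and the imaginary parts are dominated by the modulus. *)
Lemma abs_cvg_series u : cvgn (series (fun n => cmod (u n))) -> cvgn (series u).
Proof.
move=> cu.
have cR (f : cplx R -> R) : (forall z, `|f z| <= cmod z) ->
    cvgn (series (fun n => f (u n))).
  move=> hf; apply: normed_cvg; apply: series_le_cvg cu => n //=.
  exact: cmod_ge0.
have hx := cR _ ler_Re; have hy := cR _ ler_Im.
apply: cvgP (cvg_trans _ (cvg_cplx hx hy)).
rewrite (_ : series u = fun n => (series (fun n => complex.Re (u n)) n
   +i* series (fun n => complex.Im (u n)) n)%C) //.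
apply/funext => n; rewrite /series /=.
elim/big_ind3: _ => [|? ? ? ? ? ? -> ->|i _]; [by []|by []|by case: (u i)].
Qed.

(** The partial sums have the closed form (1 - z^n) / (1 - z), and z^n tends to 0
    because its modulus does. *)
Lemma cvg_geometric_cplx z : cmod z < 1 ->
  series (fun n => z ^+ n) @ \oo --> 1 / (1 - z).
Proof.
move=> z1.
have nz : 1 - z != 0.
  apply/eqP => /subr0_eq zE; move: z1; rewrite -zE.
  by rewrite [cmod _]Normc.normc1 ltxx.
have sE n : series (fun n => z ^+ n) n = (1 - z ^+ n) / (1 - z).
  apply: (mulIf nz); rewrite mulfVK // /series /= big_mkord mulrC.
  by rewrite -opprB mulNr -subrX1 opprB.
have zn : (fun n => z ^+ n) @ \oo --> (0 : cplx R).
  apply/cvg_cplxP => e e0.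
  have /cvgr0Pnorm_lt/(_ e e0) h : (GRing.exp (cmod z) : nat -> R) @ \oo --> (0 : R).
    by apply: cvg_expr; rewrite ger0_norm ?cmod_ge0.
  near=> n; rewrite sub0r cmodN cmodX; apply: le_lt_trans (ler_norm _) _.
  by near: n.
rewrite (_ : series _ = fun n => (1 - z ^+ n) / (1 - z)); last exact/funext.
rewrite -[X in X / _](subr0 1).
exact: cvgM (cvgB (cvg_cst (1 : cplx R)) zn) (cvg_cst ((1 - z)^-1 : cplx R)).
Unshelve. all: by end_near. Qed.

End ComplexConvergence.

(** * Square-summable sequences and their expansions *)

Section SquareSummable.
Variable R : realType.
Implicit Types a b : nat -> cplx R.

Lemma sq_summable_le a : sq_summable a -> forall n,
  cmod (a n) <= Num.sqrt (limn (series (fun n => cmod (a n) ^+ 2))).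
Proof.
move=> ha n; rewrite -[leLHS](ger0_norm (cmod_ge0 _)) -sqrtr_sqr ler_wsqrtr //.
have nd : nondecreasing_seq (series (fun n => cmod (a n) ^+ 2)).
  by apply: nondecreasing_series => k _ _; exact: sqr_ge0.
apply: le_trans (nondecreasing_cvgn_le nd ha n.+1).
rewrite /series /= big_nat_recr //= lerDr.
by apply: sumr_ge0 => k _; exact: sqr_ge0.
Qed.

(** Termwise, |a b| <= |a|^2 + |b|^2. *)
Lemma sq_summable_prod a b : sq_summable a -> sq_summable b ->
  cvgn (series (fun n => a n * b n)).
Proof.
move=> ha hb; apply: abs_cvg_series.
apply: (@series_le_cvg _ _ ((fun n => cmod (a n) ^+ 2 : R)
   + (fun n => cmod (b n) ^+ 2))).
- by move=> n; exact: cmod_ge0.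
- by move=> n; rewrite /= addr_ge0 ?sqr_ge0.
- move=> n; rewrite cmodM /= fctE.
  have := cmod_ge0 (a n); have := cmod_ge0 (b n).
  move: (cmod (a n)) (cmod (b n)) => x y; nra.
- exact: is_cvg_seriesD.
Qed.

End SquareSummable.

Lemma cvg_series_tail (R : realType) (u v : nat -> R) N l :
  (forall k, (k < N)%N -> u k = 0) -> (forall k, (N <= k)%N -> u k = v k) ->
  series v @ \oo --> l -> series u @ \oo --> l - series v N.
Proof.
move=> u0 uv vl.
have hl : (fun n => series v n - series v N) @ \oo --> l - series v N.
  exact: cvgB vl (cvg_cst (series v N)).
apply: cvg_trans hl; apply: near_eq_cvg; exists N => // n /= Nn.
rewrite sub_series_geq // [RHS](big_cat_nat (n := N)) //=.
rewrite [X in _ = X + _]big1_seq ?add0r => [|k]; last first.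
  by rewrite mem_index_iota => /andP[_ /andP[_ /u0]].
by apply: eq_big_nat => k /andP[/uv].
Qed.

Section L2Family.
Variables (R : realType) (T : Type) (e : nat -> T -> cplx R).
Implicit Types (a b : nat -> cplx R) (f g : l2fun e).

(** Without this property [coef e f] would be one arbitrarily chosen coefficient
    sequence of f. *)
Definition coef_unique := forall a b (f : T -> cplx R),
  sq_summable a -> sq_summable b -> expands e a f -> expands e b f -> a = b.

Definition l2_converges := forall a x, sq_summable a ->
  cvgn (series (fun n => a n * e n x)).

Lemma coefP f : sq_summable (coef e f) /\ expands e (coef e f) f.
Proof.
rewrite /coef; case: xgetP => [b _ //|h].
by have /asboolP[a ha hf] := l2fun_in f; have := h a (conj ha hf).
Qed.

Lemma expands_inj a (f g : T -> cplx R) : expands e a f -> expands e a g -> f = g.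
Proof.
move=> hf hg; apply/funext => x.
have <- := cvg_lim (@norm_hausdorff _ (cplx R)) (hf x).
by have <- := cvg_lim (@norm_hausdorff _ (cplx R)) (hg x).
Qed.

Lemma l2fun_coef_inj f g : coef e f = coef e g -> f = g.
Proof.
move=> fg; apply: val_inj; have [_ hf] := coefP f; have [_ hg] := coefP g.
by rewrite fg in hf; exact: expands_inj hf hg.
Qed.

Lemma cmod_coef_le f n : cmod (coef e f n) <= l2norm f.
Proof. exact: (sq_summable_le (coefP f).1 n). Qed.

Hypothesis eU : coef_unique.

Lemma coef_eq a f : sq_summable a -> expands e a f -> coef e f = a.
Proof. by move=> ha hf; have [hb hg] := coefP f; exact: eU hb ha hg hf. Qed.

Lemma l2coefZD (k : cplx R) f g :
  coef e (k *: f + g) = fun n => k * coef e f n + coef e g n.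
Proof.
have [hf ef] := coefP f; have [hg eg] := coefP g.
apply: coef_eq; first by apply: sq_summableZD.
have := @expandsZD _ _ _ k _ _ _ _ ef eg.
by [].
Qed.

Lemma l2coefB f g n : coef e (f - g) n = coef e f n - coef e g n.
Proof. by rewrite -scaleN1r addrC l2coefZD mulN1r addrC. Qed.

Lemma coef_basis n : coef e (Defs.basis e n) = fun k => (k == n)%:R.
Proof.
have a0 k : (n.+1 <= k)%N -> (k == n)%:R = 0 :> cplx R by case: ltngtP.
apply: coef_eq; first exact: sq_summable_fin a0.
move=> x; rewrite /Defs.basis /= (_ : e n x = \sum_(k < n.+1) (k == n :> nat)%:R * e k x).
  by apply: series_finC => k /a0 ->; rewrite mul0r.
rewrite (bigD1 ord_max) //= eqxx mul1r big1 ?addr0 // => i ni.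
by rewrite -val_eqE /= in ni; rewrite (negbTE ni) mul0r.
Qed.

Lemma l2coef0 n : coef e (0 : l2fun e) n = 0.
Proof. by rewrite -(subrr (0 : l2fun e)) l2coefB subrr. Qed.

Lemma coef_fin_sum a N k :
  coef e (\sum_(n < N) a n *: Defs.basis e n) k = if (k < N)%N then a k else 0.
Proof.
elim: N => [|N IH]; first by rewrite big_ord0 l2coef0.
have -> : \sum_(n < N.+1) a n *: Defs.basis e n =
    a N *: Defs.basis e N + \sum_(n < N) a n *: Defs.basis e n.
  by rewrite big_ord_recr addrC.
rewrite l2coefZD IH coef_basis [(k < N.+1)%N]ltnS.
by case: ltngtP => [_|_|->]; rewrite ?mulr1 ?mulr0 ?addr0 ?add0r.
Qed.

(** Truncation at N removes exactly the first N coefficients, so that the squared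
    error is a tail of the convergent series for the squared norm. *)
Lemma l2norm_tail f (eps : R) : 0 < eps -> exists N0, forall N, (N0 <= N)%N ->
  l2norm (\sum_(n < N) coef e f n *: Defs.basis e n - f) < eps.
Proof.
move=> eps0; have [hf _] := coefP f.
set s := fun n => cmod (coef e f n) ^+ 2.
have e20 : 0 < eps ^+ 2 by rewrite exprn_gt0.
have sL : series s @ \oo --> limn (series s) by [].
have /cvgrPdist_lt/(_ _ e20)[N0 _ h] := sL.
exists N0 => N /h /= {}h.
have tE k : coef e (\sum_(n < N) coef e f n *: Defs.basis e n - f) k
    = if (k < N)%N then 0 else - coef e f k.
  by rewrite l2coefB coef_fin_sum; case: ifP; rewrite ?subrr ?sub0r.
set g := _ - f in tE *.
have tl : series (fun k => cmod (coef e g k) ^+ 2 : R) @ \oo -->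
    limn (series s) - series s N.
  apply: (cvg_series_tail _ _ sL) => k hk; rewrite tE.
    by rewrite hk cmod0 expr0n.
  by rewrite ltnNge hk cmodN.
have Hd : hausdorff_space R by exact: Rhausdorff.
rewrite /l2norm (cvg_lim Hd tl).
rewrite -[ltRHS](ger0_norm (ltW eps0)) -sqrtr_sqr ltr_sqrt //.
exact: le_lt_trans (ler_norm _) h.
Qed.

Hypothesis eC : l2_converges.

Lemma limn_in_l2span a : sq_summable a ->
  (fun x => limn (series (fun n => a n * e n x))) \in l2span e.
Proof. by move=> ha; apply/asboolP; exists a => // x; exact: eC. Qed.

Lemma coef_onto a : sq_summable a -> exists f, coef e f = a.
Proof.
move=> ha; exists (L2Fun (limn_in_l2span ha)); apply: coef_eq => // x.
exact: eC.
Qed.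

End L2Family.

(** * Maps that keep the coefficients *)

Section Transfer.
Variables (R : realType) (S T : Type).
Variables (d : nat -> S -> cplx R) (e : nat -> T -> cplx R).
Hypotheses (eU : coef_unique e) (eC : l2_converges e).

Definition transfer (f : l2fun d) : l2fun e :=
  sval (cid (coef_onto eU eC (coefP f).1)).

Lemma coef_transfer f : coef e (transfer f) = coef d f.
Proof. by rewrite /transfer; case: cid. Qed.

Hypothesis dU : coef_unique d.

Lemma transfer_is_linear : linear transfer.
Proof.
move=> k f g; apply: l2fun_coef_inj.
rewrite [LHS]coef_transfer.
rewrite [LHS](l2coefZD dU).
rewrite [RHS](l2coefZD eU).
by apply: (congr2 (fun (u v : nat -> cplx R) n => k * u n + v n))
  (esym _) (esym _); exact: coef_transfer.
Qed.

Lemma exists_coef_preserving :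
  exists psi : {linear l2fun d -> l2fun e}, forall f, coef e (psi f) = coef d f.
Proof.
pose m := GRing.isLinear.Build _ _ _ _ transfer transfer_is_linear.
pose psi : {linear l2fun d -> l2fun e} := HB.pack transfer m.
by exists psi => f; exact: coef_transfer.
Qed.

End Transfer.

Section L2Map.
Variables (R : realType) (S T : Type).
Variables (d : nat -> S -> cplx R) (e : nat -> T -> cplx R).
Hypotheses (dU : coef_unique d) (eU : coef_unique e).

(** Fix k and let s be a partial sum of f of length N > k.  By linearity psi s is
    the same combination of the target basis, so its k-th coefficient is that of
    f; and psi s is close to psi f in norm, which bounds the difference of the
    k-th coefficients. *)
Lemma l2_continuous_basis_coef (psi : {linear l2fun d -> l2fun e}) :
  l2_continuous psi -> (forall n, psi (Defs.basis d n) = Defs.basis e n) ->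
  forall f, coef e (psi f) = coef d f.
Proof.
move=> psi_cont psi_basis f; apply/funext => k; apply/subr0_eq/cmod0_eq0.
apply/eqP; rewrite eq_le cmod_ge0 andbT; apply/ler_addgt0Pr => eps eps0.
rewrite add0r; have [delta delta0 hdelta] := psi_cont f _ eps0.
have [N0 hN0] := l2norm_tail dU f delta0.
pose N := maxn N0 k.+1; pose s := \sum_(n < N) coef d f n *: Defs.basis d n.
have psi_s : psi s = \sum_(n < N) coef d f n *: Defs.basis e n.
  by rewrite linear_sum; apply: eq_bigr => n _; rewrite linearZ_LR psi_basis.
apply/ltW; apply: le_lt_trans (hdelta s (hN0 _ (leq_maxl _ _))).
apply: le_trans (cmod_coef_le _ k).
by rewrite l2coefB // psi_s coef_fin_sum // leq_max ltnSn orbT -opprB cmodN.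
Qed.

Section CoefPreserving.
Variable psi : {linear l2fun d -> l2fun e}.
Hypothesis psiE : forall f, coef e (psi f) = coef d f.

Lemma coef_preserving_continuous : l2_continuous psi.
Proof.
move=> f eps eps0; exists eps => // g.
by rewrite -linearB /l2norm psiE.
Qed.

Lemma coef_preserving_basis n : psi (Defs.basis d n) = Defs.basis e n.
Proof. by apply: l2fun_coef_inj; rewrite psiE !coef_basis. Qed.

Hypothesis dC : l2_converges d.

Lemma coef_preserving_unitary : unitary psi.
Proof.
split=> [|f g]; last by rewrite /inner !psiE.
by exists (transfer dU dC) => f; apply: l2fun_coef_inj;
  rewrite ?(psiE, coef_transfer).
Qed.

End CoefPreserving.

End L2Map.

(** * The monomials on the disk *)

Section PowerSeries.
Variable R : realType.

(** The subtracted term makes the induction on N work; the bound used below is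
    2 r^m. *)
Lemma geometric_tail_le (r : R) m N : 0 <= r <= 1 / 2 -> (m <= N)%N ->
  \sum_(m <= k < N) r ^+ k <= 2 * r ^+ m - 2 * r ^+ N.
Proof.
move=> /andP[r0 r2] /subnKC <-; elim: (N - m)%N => [|p IH].
  by rewrite addn0 big_geq // subrr.
rewrite addnS big_nat_recr ?leq_addr //= exprS.
have : 0 <= r ^+ (m + p) by exact: exprn_ge0.
move: IH; set x := r ^+ (m + p); nra.
Qed.

(** Let n be minimal with c n != 0.  At a real point 0 < r <= 1/2 the term of
    index n has modulus |c n| r^n, and the terms after it sum to at most
    2 M r^(n+1); since the whole sum is 0, |c n| <= 2 M r for all such r. *)
Lemma power_series_eq0 (c : nat -> cplx R) (M : R) :
  (forall k, cmod (c k) <= M) ->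
  (forall z : disk R, series (fun n => c n * monomial n z) @ \oo --> (0 : cplx R)) ->
  forall n, c n = 0.
Proof.
move=> cM c0; elim/ltn_ind => n IH.
have key (r : R) : 0 < r <= 1 / 2 -> cmod (c n) <= 2 * M * r.
  move=> /andP[r0 r2].
  have zr : cmod (r%:C%C : cplx R) = r by rewrite cmod_real // ltW.
  have z1 : cmod (r%:C%C : cplx R) < 1 by rewrite zr; lra.
  pose z : disk R := exist _ (r%:C%C : cplx R) z1.
  have /cvg_cplxP hr := c0 z.
  have cr k : cmod (c k * monomial k z) = cmod (c k) * r ^+ k.
    by rewrite cmodM /monomial /= cmodX zr.
  rewrite -(ler_pM2r (exprn_gt0 n r0)) -cr; apply/ler_addgt0Pr => eps eps0.
  have [N0 _ /(_ (maxn N0 n.+1))] := hr _ eps0.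
  rewrite /= leq_maxl => /(_ isT); set N := maxn N0 _.
  have nN : (n < N)%N by rewrite leq_max ltnSn orbT.
  rewrite sub0r cmodN /series /= (big_cat_nat (n := n.+1)) //=.
  rewrite big_nat_recr //= big_nat big1 => [|k kn]; last by rewrite IH ?mul0r.
  rewrite add0r; set x := c n * _; set t := \sum_(_ <= _ < _) _ => xt.
  have tle : cmod t <= M * (2 * r ^+ n.+1).
    apply: le_trans (cmod_sum _ _ _) _.
    have M0 : 0 <= M by exact: le_trans (cmod_ge0 _) (cM 0%N).
    apply: (@le_trans _ _ (M * \sum_(n.+1 <= k < N) r ^+ k)).
      rewrite mulr_sumr; apply: ler_sum => k _; rewrite cr ler_wpM2r //.
      by rewrite exprn_ge0 // ltW.
    apply: ler_wpM2l => //; apply: le_trans (geometric_tail_le _ nN) _.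
      by rewrite ltW.
    by rewrite gerBl mulr_ge0 // exprn_ge0 // ltW.
  have -> : x = (x + t) - t by rewrite addrK.
  apply: le_trans (cmodD _ _) _; rewrite cmodN addrC.
  have -> : 2 * M * r * r ^+ n = M * (2 * r ^+ n.+1) by rewrite exprS; ring.
  exact: lerD tle (ltW xt).
apply: cmod0_eq0; apply/eqP; rewrite eq_le cmod_ge0 andbT leNgt.
apply/negP => x0; set x := cmod (c n) in key x0 *.
have xM : x <= M by exact: cM.
have M0 : 0 < M by exact: lt_le_trans xM.
(* At r = x / (4 M) the bound 2 M r is x / 2. *)
have := key (x / (4 * M)); rewrite divr_gt0 ?mulr_gt0 //=.
rewrite ler_pdivrMr ?mulr_gt0 // => h.
have {h} := h ltac:(lra).
rewrite (_ : 2 * M * _ = x / 2); first lra.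
by field; rewrite gt_eqF.
Qed.

Lemma coef_unique_monomial : coef_unique (@monomial R).
Proof.
move=> a b f ha hb fa fb; apply/funext => n; apply/subr0_eq.
have hc := @sq_summableZD _ (-1) _ _ hb ha.
have fc := @expandsZD _ _ _ (-1) _ _ _ _ fb fa.
have : -1 * b n + a n = 0.
  apply: (power_series_eq0 (sq_summable_le hc)) => z.
  by have := fc z; rewrite scaleN1r addNr.
by rewrite mulN1r addrC.
Qed.

Lemma sq_summable_geometric (z : disk R) : sq_summable (fun n => sval z ^+ n).
Proof.
rewrite /sq_summable; case: z => z /= z1.
rewrite (_ : (fun n => _) = geometric 1 (cmod z ^+ 2)).
  apply: is_cvg_geometric_series.
  by rewrite ger0_norm ?sqr_ge0 // expr_lt1 ?cmod_ge0.
by apply/funext => n; rewrite /= cmodX mul1r -!exprM mulnC.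
Qed.

Lemma l2_converges_monomial : l2_converges (@monomial R).
Proof.
by move=> a z ha; apply: sq_summable_prod ha _; exact: sq_summable_geometric.
Qed.

End PowerSeries.

(** * The binomial family *)

Section BinomialFamily.
Variable R : realType.

Lemma coef_unique_binom : coef_unique (@binom_fun R).
Proof. by move=> a b f _ _; exact: expands_binom_inj. Qed.

Lemma l2_converges_binom : l2_converges (@binom_fun R).
Proof. by move=> a x _; exact: cvgP (@expands_binom R a x). Qed.

Lemma coef_f_triangle (a : disk R) :
  coef (@binom_fun R) (f_triangle a) = pow_conj a.
Proof.
by apply: coef_binom; [exact: pow_conj_summable | exact: expands_binom].
Qed.

End BinomialFamily.

Theorem theorem3p3 (R : realType) :
  let psi_spec (psi : {linear HKC R -> Hardy R}) :=
    l2_continuous psi /\ (forall n, psi (e_ R n) = zpow R n) in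
  [/\ exists psi : {linear HKC R -> Hardy R}, psi_spec psi,
      (forall psi phi : {linear HKC R -> Hardy R},
         psi_spec psi -> psi_spec phi -> psi =1 phi)
    & forall psi : {linear HKC R -> Hardy R}, psi_spec psi ->
      [/\ unitary psi,
          (forall (a : disk R) (x : nat),
             f_triangle a x = (1 + (sval a)^* ) ^+ x),
          (forall a z : disk R,
             psi (f_triangle a) z = 1 / (1 - sval z * (sval a)^* ))
        & (forall a b : disk R,
             inner (f_triangle a) (f_triangle b) =
             1 / (1 - (sval a)^* * sval b))]].
Proof.
have dU := @coef_unique_binom R; have eU := @coef_unique_monomial R.
have dC := @l2_converges_binom R; have eC := @l2_converges_monomial R.
have psiE (psi : {linear HKC R -> Hardy R}) : l2_continuous psi /\
    (forall n, psi (e_ R n) = zpow R n) ->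
    forall f, coef (@monomial R) (psi f) = coef (@binom_fun R) f.
  by case=> psi_cont psi_basis; exact: l2_continuous_basis_coef.
have hd : hausdorff_space (cplx R) by exact: norm_hausdorff.
move=> psi_spec; split.
- have [psi psi_coef] := exists_coef_preserving eU eC dU.
  exists psi; split; first exact: coef_preserving_continuous.
  exact: coef_preserving_basis.
- move=> psi phi hpsi hphi f; apply: l2fun_coef_inj.
  by rewrite (psiE _ hpsi) (psiE _ hphi).
move=> psi hpsi; split.
- exact: coef_preserving_unitary (psiE _ hpsi) dC.
- by move=> a x; exact: black_triangle_pow_conj.
- move=> a z.
  have [_ /(_ z)] := coefP (psi (f_triangle a)).
  rewrite (psiE _ hpsi) coef_f_triangle => /(cvg_lim hd) <-.
  apply: cvg_lim => //; rewrite (_ : (fun n => _) =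
    fun n => (sval z * (sval a)^* ) ^+ n).
    by apply: cvg_geometric_cplx; rewrite mulrC cmod_conjM_disk.
  by apply/funext => n; rewrite /pow_conj /monomial exprMn mulrC.
- move=> a b; rewrite /inner !coef_f_triangle; apply: cvg_lim => //.
  rewrite (_ : (fun n => _) = fun n => ((sval a)^* * sval b) ^+ n).
    exact: cvg_geometric_cplx (cmod_conjM_disk a b).
  by apply/funext => n; rewrite /pow_conj exprMn rmorphXn /= conjCK.
Qed.
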